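(* Let $n,k\ge 1$ be integers. The number of maximum rook placements on $B^{-}_{n,k}$ is: \begin{itemize} \item if $k$ is even: $$(n!)^{\frac{k}{2}}\sum_{0=j_0\le j_1\le\cdots\le j_{k/2}\le n}\ \prod_{\ell=1}^{k/2}\binom{n-j_{\ell-1}}{n-j_\ell}\binom{n}{j_\ell},$$ where the sum is over integers $j_1,\dots,j_{k/2}$ as indicated, with $j_0=0$; \item if $k$ is odd: $(n!)^{\frac{k+1}{2}}$. \end{itemize}
   Context: The linear configuration $B^{-}_{n,k}$ is a $k$-tuple $(B^{(1)},\dots,B^{(k)})$ of $n\times n$ chessboards with rows and columns numbered $1,\dots,n$. Two rooks are attacking on $B^{-}_{n,k}$ if they are in the same row or the same column of the same board, or if one is in the $j$th row of $B^{(i-1)}$ and the other is in the $j$th column of $B^{(i)}$ for some $1\le j\le n$ and $2\le i\le k$. A set of rooks (at most one per cell) is non-attacking if no pair is attacking. A maximum rook placement is a non-attacking placement whose number of rooks is the largest possible among all non-attacking placements on the board; a placement is determined by its set of occupied cells. *)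

(* Defs.v *)
From mathcomp Require Import all_boot.

Set Implicit Arguments.
Unset Strict Implicit.
Unset Printing Implicit Defensive.

(* A triple (board, row, column), all numbered from 0 instead of from 1. *)
Definition cell (n k : nat) : finType := ('I_k * 'I_n * 'I_n)%type.

Definition board n k (c : cell n k) : 'I_k := c.1.1.
Definition row n k (c : cell n k) : 'I_n := c.1.2.
Definition col n k (c : cell n k) : 'I_n := c.2.

Section Placements.

Variables n k : nat.
Implicit Types (c d : cell n k) (P Q : {set cell n k}).

Definition same_board_attack c d :=
  (board c == board d) && ((row c == row d) || (col c == col d)).

Definition next_board_attack c d :=
  ((board c).+1 == board d :> nat) && (row c == col d).

Definition attacking c d :=
  [|| same_board_attack c d, next_board_attack c d | next_board_attack d c].

(* The test c != d is needed because [attacking] is reflexive. *)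
Definition nonattacking P :=
  [forall c in P, forall d in P, (c != d) ==> ~~ attacking c d].

Definition max_placement P :=
  nonattacking P && [forall Q, nonattacking Q ==> (#|Q| <= #|P|)].

End Placements.

Section Chains.

Variables n m : nat.

(* A family j_0, ..., j_m of integers in {0, ..., n}; for l : 'I_m, standing
   for the index l + 1 in {1, ..., m}, [jprev j l] is j_l and [jcur j l] is
   j_(l+1). *)
Definition jprev (j : {ffun 'I_m.+1 -> 'I_n.+1}) (l : 'I_m) : nat :=
  j (widen_ord (leqnSn m) l).
Definition jcur (j : {ffun 'I_m.+1 -> 'I_n.+1}) (l : 'I_m) : nat :=
  j (lift ord0 l).

Definition chain (j : {ffun 'I_m.+1 -> 'I_n.+1}) : bool :=
  (j ord0 == 0 :> nat) && [forall l : 'I_m, jprev j l <= jcur j l].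

End Chains.

(* Main.v *)
Require Import Defs.
From mathcomp Require Import all_boot.

Set Implicit Arguments.
Unset Strict Implicit.
Unset Printing Implicit Defensive.

(** The rooks on one board form a partial bijection between the rows and the
columns that they occupy, and the only other constraint is that the rows
occupied on a board avoid the columns occupied on the next one.  Hence two
consecutive boards carry at most [n] rooks together, the number of rows used
on the first plus the number of columns used on the second.  Group the boards
in consecutive pairs starting from the last one; if [k] is odd, the first
board remains alone and is paired with a virtual empty board placed before it.
Every pair carries at most [n] rooks, and putting the [n] diagonal rooks on
the second board of each pair reaches this bound everywhere at once.  So the
maximum placements are exactly the non-attacking ones for which each pair is
saturated (lemma [max_placement_slices]).

This condition only links consecutive boards, so the placements are counted by
a transfer recursion over the boards (lemma [card_max_placements]).  Let [A] be
the contents of the board before a pair, let the pair contain [n - j] and then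
[j] rooks.  The first board of the pair has [n - j] columns outside the
[#|A|] rows of [A], and an injection of these columns into the rows; the second
one has exactly the [j] columns complementary to those rows, and an injection
again.  The number of choices is
  ['C(n - #|A|, n - j) * n ^_ (n - j) * n ^_ j =
   n`! * ('C(n - #|A|, n - j) * 'C(n, j))],
and only [j] matters for the following boards.  Up to the factors [n`!] this is
the transfer recursion of the sum over chains (lemma [placement_walks_even]).
If [k] is odd, the lone first board is a permutation matrix; then every chain
starts from [n], so it is constant and contributes [1]. *)

(** * Sums over walks and transfer recursions *)

Section Walks.
Variable T : finType.
Implicit Types (w : nat -> T -> T -> nat) (x y : T).

(** The weight [w] of a step also receives the number of steps that remain
after it: saturation is required at every second board counted from the last
one. *)
Fixpoint walk_sum w r x : nat :=
  if r is r'.+1 then \sum_y w r' x y * walk_sum w r' y else 1.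

Definition fcons m x (g : {ffun 'I_m -> T}) : {ffun 'I_m.+1 -> T} :=
  [ffun i => oapp g x (unlift ord0 i)].

Lemma fcons0 m x (g : {ffun 'I_m -> T}) : fcons x g ord0 = x.
Proof. by rewrite ffunE unlift_none. Qed.

Lemma fconsS m x (g : {ffun 'I_m -> T}) i : fcons x g (lift ord0 i) = g i.
Proof. by rewrite ffunE liftK. Qed.

Lemma sum_ffun_fcons m x (F : {ffun 'I_m.+1 -> T} -> nat) :
  \sum_(f : {ffun 'I_m.+1 -> T} | f ord0 == x) F f = \sum_g F (fcons x g).
Proof.
rewrite (reindex_onto (fcons x)
  (fun f : {ffun _ -> T} => [ffun i => f (lift ord0 i)])) /=.
  apply: eq_bigl => g; rewrite fcons0 eqxx /=.
  by apply/eqP/ffunP => i; rewrite ffunE fconsS.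
move=> f /eqP f0; apply/ffunP => i.
by case: (unliftP ord0 i) => [j ->|->]; rewrite ?fconsS ?fcons0 ?ffunE.
Qed.

(** The closed form of the recursion: both the number of placements and the sum
over chains are compared through it. *)
Lemma sum_prod_walk w r x :
  \sum_(f : {ffun 'I_r.+1 -> T} | f ord0 == x)
     \prod_(l < r) w (r - l.+1) (f (widen_ord (leqnSn r) l)) (f (lift ord0 l))
  = walk_sum w r x.
Proof.
elim: r x => [|r IHr] x.
  rewrite (eq_bigr (fun _ => 1)) => [|f _]; last by rewrite big_ord0.
  rewrite sum_ffun_fcons sum_nat_const muln1.
  by rewrite card_ffun card_ord expn0.
rewrite sum_ffun_fcons /=.
rewrite (partition_big (fun g : {ffun _ -> T} => g ord0) xpredT) //=.
apply: eq_bigr => y _; rewrite -IHr big_distrr /=.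
apply: eq_bigr => g /eqP g0; rewrite big_ord_recl; congr (_ * _).
  rewrite fconsS g0 subSS subn0; congr (w _ _ _).
  by rewrite -[RHS](fcons0 x g); congr (fcons x g _); apply: val_inj.
apply: eq_bigr => l _; rewrite fconsS subSS; congr (w _ _ _).
by rewrite -[RHS](fconsS x); congr (fcons x g _); apply: val_inj.
Qed.

End Walks.

Lemma prod_nat_bool (I : finType) (b : pred I) :
  \prod_i (b i : nat) = [forall i, b i].
Proof.
have -> : [forall i, b i] = \big[andb/true]_i b i by rewrite big_andE.
by rewrite (big_morph nat_of_bool (fun x y => esym (mulnb x y)) erefl).
Qed.

(** * Placements on one board as partial bijections *)

Section Matchings.
Variable n : nat.
Implicit Types (A B : {set 'I_n * 'I_n}) (C X : {set 'I_n}).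

Definition rows B : {set 'I_n} := [set p.1 | p in B].
Definition cols B : {set 'I_n} := [set p.2 | p in B].

Definition matching B := (#|rows B| == #|B|) && (#|cols B| == #|B|).

Lemma matchingP B :
  reflect ({in B &, injective fst} /\ {in B &, injective snd}) (matching B).
Proof. by apply: (iffP andP) => -[/imset_injP ? /imset_injP ?]. Qed.

Lemma card_rows B : matching B -> #|rows B| = #|B|.
Proof. by case/andP => /eqP. Qed.

Lemma card_cols B : matching B -> #|cols B| = #|B|.
Proof. by case/andP => _ /eqP. Qed.

(** A matching with column set [C] is the graph of an injective function that
sends each column of [C] to the row of its rook. *)
Lemma card_matching_cols C :
  #|[set B | matching B && (cols B == C)]| = n ^_ #|C|.
Proof.
pose graph (f : {ffun {c | c \in C} -> 'I_n}) :=
  [set (f c, val c) | c in predT].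
have graphE f r (c : {c | c \in C}) : ((r, val c) \in graph f) = (r == f c).
  apply/imsetP/eqP => [[d _ [-> /val_inj ->]] // | ->].
  by exists c.
have graph_inj : injective graph.
  move=> f g fg; apply/ffunP => c; apply/eqP.
  by rewrite -graphE -fg graphE.
have -> : n ^_ #|C| = #|'I_n| ^_ #|{: {c | c \in C}}|.
  by rewrite card_ord card_sig.
rewrite -card_inj_ffuns -(card_imset _ graph_inj).
congr #|pred_of_set _|; apply/setP => B; rewrite inE.
apply/andP/imsetP => [[/matchingP[rB cB] /eqP BC] | [f]].
  have ex (c : {c | c \in C}) : exists r, (r, val c) \in B.
    have: val c \in cols B by rewrite BC; apply: valP.
    case/imsetP => -[r d] rdB /= cd.
    by exists r; rewrite cd.
  pose f := [ffun c => xchoose (ex c)].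
  have fB c : (f c, val c) \in B by rewrite ffunE; exact: (xchooseP (ex c)).
  exists f.
    rewrite inE; apply/injectiveP => c d fcd; apply: val_inj.
    by case: (rB _ _ (fB c) (fB d) fcd).
  apply/setP => -[r d]; apply/idP/imsetP => [rdB | [c _ ->] //].
  have dC : d \in C by rewrite -BC; apply/imsetP; exists (r, d).
  exists (Sub d dC) => //.
  exact: (cB _ _ rdB (fB (Sub d dC)) erefl).
rewrite inE => /injectiveP f_inj ->; split.
  apply/matchingP; split=> _ _ /imsetP[c _ ->] /imsetP[d _ ->] /=.
    by move/f_inj ->.
  by move/val_inj ->.
apply/eqP/setP => d; apply/imsetP/idP => [[_ /imsetP[c _ ->] ->] | dC].
  exact: (valP c).
exists (f (Sub d dC), d) => //.
by rewrite (graphE f _ (Sub d dC)).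
Qed.

(** A sum over matchings that only depends on their size can be computed from
their column sets, each of them counted with its [n ^_ #|C|] matchings. *)
Lemma sum_matchings (p : pred {set 'I_n}) (F : nat -> nat) :
  \sum_(B | matching B && p (cols B)) F #|B| =
  \sum_(C | p C) n ^_ #|C| * F #|C|.
Proof.
rewrite (partition_big cols p) => [|B /andP[]//]; apply: eq_bigr => C pC.
rewrite -card_matching_cols -sum_nat_const big_set.
apply: congr_big => // [B|B /andP[/andP[mB _] /eqP<-]]; last first.
  by rewrite card_cols.
by rewrite unfold_in -andbA; case: eqP => [->|_]; rewrite ?pC ?andbF.
Qed.

(** * The transfer recursion for placements *)

(** [B] may follow [A] on the next board when [q] more boards come after [B];
if [q] is even, [B] closes a pair, which has to be saturated. *)
Definition compatible (q : nat) A B :=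
  [&& matching B, [disjoint rows A & cols B]
    & ~~ odd q ==> (#|A| + #|B| == n)].

Definition placement_walks := walk_sum (fun q A B => compatible q A B : nat).

(** When the continuation only depends on the number of rooks on the next
board, the sum over the contents [B] of that board becomes a sum over its
column set [C].  Saturation forces [C], which avoids the rows of [A], to be
their whole complement. *)
Lemma placement_walksS r A (F : nat -> nat) :
    (forall B, matching B -> placement_walks r B = F #|B|) ->
    matching A ->
  placement_walks r.+1 A =
  \sum_(C : {set 'I_n} |
          [disjoint rows A & C] && (~~ odd r ==> (C == ~: rows A)))
     n ^_ #|C| * F #|C|.
Proof.
move=> HF mA; rewrite /placement_walks /= -/placement_walks.
rewrite -sum_matchings big_mkcond /= [RHS]big_mkcond /=.
apply: eq_bigr => B _; rewrite /compatible.
case mB: (matching B) => //=.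
rewrite -(HF _ mB); case dAB: [disjoint _ & _] => //=.
suff ->: (cols B == ~: rows A) = (#|A| + #|B| == n).
  by case: (~~ _ ==> _); rewrite ?mul1n.
move: dAB; rewrite disjoint_sym disjoints_subset => sBA.
rewrite eqEcard sBA /= (card_cols mB).
have := cardsC (rows A); rewrite card_ord (card_rows mA) => cA.
have := subset_leq_card sBA; rewrite (card_cols mB) => le.
by rewrite -[X in _ + _ == X]cA eqn_add2l eqn_leq le.
Qed.

Definition chain_weight (x y : 'I_n.+1) :=
  (x <= y) * ('C(n - x, n - y) * 'C(n, y)).

Definition chain_walks := walk_sum (fun=> chain_weight).

Lemma sum_subsets_card (X : {set 'I_n}) (F : nat -> nat) :
  \sum_(C : {set 'I_n} | C \subset X) F #|C| =
  \sum_(a < n.+1) 'C(#|X|, a) * F a.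
Proof.
have ltC (C : {set 'I_n}) : #|C| < n.+1.
  by rewrite ltnS -[n in _ <= n]card_ord max_card.
rewrite (partition_big (fun C : {set 'I_n} => Ordinal (ltC C)) xpredT) //=.
apply: eq_bigr => a _; rewrite -cards_draws -sum_nat_const big_set.
by apply: eq_big => [C|C /andP[_ /eqP <-]].
Qed.

(** One pair of boards produces the factor [n`!] and one step of the chain, the
entry of the chain being the number of rooks on the second board of the
pair. *)
Lemma placement_walks_even m A : matching A ->
  placement_walks m.*2 A = n`! ^ m * chain_walks m (inord #|A|).
Proof.
elim: m A => [|m IHm] A mA; first by rewrite expn0 mul1n.
have leA B : matching B -> #|B| <= n.
  by move=> mB; rewrite -(card_rows mB) -[n in _ <= n]card_ord max_card.
rewrite doubleS (@placement_walksS _ _ (fun b => n ^_ (n - b) *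
  (n`! ^ m * chain_walks m (inord (n - b))))) //; last first.
  move=> B mB.
  rewrite (@placement_walksS _ _ (fun b => n`! ^ m * chain_walks m (inord b))
    IHm mB) odd_double /=.
  rewrite (big_pred1 (~: rows B)) => [|C]; last first.
    rewrite disjoint_sym disjoints_subset andbC /=.
    by case: eqP => [->|_]; rewrite ?subxx.
  suff ->: #|~: rows B| = n - #|B| by [].
  by rewrite cardsCs setCK card_ord (card_rows mB).
rewrite /= odd_double /=.
rewrite (eq_bigl (fun C => C \subset ~: rows A)) => [|C]; last first.
  by rewrite andbT disjoint_sym disjoints_subset.
rewrite (sum_subsets_card _ (fun c => n ^_ c * (n ^_ (n - c) *
  (n`! ^ m * chain_walks m (inord (n - c)))))).
rewrite cardsCs setCK card_ord (card_rows mA).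
(* The first board of the pair holds [a] rooks, the second one [j = n - a]. *)
rewrite (reindex_inj rev_ord_inj) /chain_walks /= -/chain_walks big_distrr /=.
apply: eq_bigr => j _; have lejn : j <= n by rewrite -ltnS.
rewrite subSS subKn // inord_val /chain_weight inordK ?ltnS ?leA //.
(* The condition [#|A| <= j] of a chain is automatic: otherwise the binomial
   coefficient vanishes. *)
case: leqP => [leAj|ltjA]; last first.
  by rewrite bin_small ?muln0 // ltn_sub2l // (leq_trans ltjA) ?leA.
(* [n`! = n ^_ (n - j) * j`!] and [n ^_ j = 'C(n, j) * j`!]. *)
rewrite mul1n expnS -(ffact_fact (leq_subr j n)) subKn // -(bin_ffact n j).
rewrite -!mulnA mulnCA; congr (_ * _).
rewrite [in RHS](mulnCA (_ ^ m)) [RHS]mulnCA; congr (_ * _).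
by rewrite mulnCA; congr (_ * _); rewrite mulnCA.
Qed.

Lemma chain_walks_max m : chain_walks m ord_max = 1.
Proof.
elim: m => // m IHm; rewrite /chain_walks /= -/chain_walks.
rewrite (bigD1 ord_max) //= IHm big1 => [|j jn].
  by rewrite /chain_weight /= leqnn subnn bin0 binn.
rewrite /chain_weight /= leqNgt; suff -> : j < n by [].
by rewrite ltn_neqAle -ltnS ltn_ord andbT.
Qed.

Lemma matching0 : matching set0.
Proof. by rewrite /matching /rows /cols !imset0 !cards0. Qed.

(** The lone first board is saturated against the empty virtual board, so it
uses all the columns; the chain that follows starts from its maximum [n]. *)
Lemma placement_walks_odd m :
  placement_walks m.*2.+1 set0 = n`! ^ m.+1.
Proof.
rewrite (@placement_walksS _ _ (fun b => n`! ^ m * chain_walks m (inord b))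
  (@placement_walks_even m) matching0) odd_double /=.
rewrite /rows imset0 setC0 (big_pred1 setT) => [|C]; last first.
  by rewrite disjoint_sym disjoints_subset setC0 subsetT.
rewrite cardsT card_ord ffactnn expnS.
have ->: inord n = ord_max :> 'I_n.+1 by apply: val_inj; rewrite /= inordK.
by rewrite chain_walks_max muln1.
Qed.

End Matchings.

(** * Characterization of the maximum placements *)

Section Slices.
Variables n k : nat.
Implicit Types (P Q : {set cell n k}) (l : 'I_k).

(** The contents of the virtual empty board (index 0), then those of the [k]
boards; the virtual board makes the first board an ordinary step. *)
Definition slices P : {ffun 'I_k.+1 -> {set 'I_n * 'I_n}} :=
  [ffun i => if unlift ord0 i is Some b
             then [set p | (b, p.1, p.2) \in P] else set0].

Definition unslices (f : {ffun 'I_k.+1 -> {set 'I_n * 'I_n}}) :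
    {set cell n k} :=
  [set c | (row c, col c) \in f (lift ord0 (board c))].

Lemma slices0 P : slices P ord0 = set0.
Proof. by rewrite ffunE unlift_none. Qed.

Lemma mem_slicesS P l p :
  (p \in slices P (lift ord0 l)) = ((l, p.1, p.2) \in P).
Proof. by rewrite ffunE liftK inE. Qed.

Lemma slicesK : cancel slices unslices.
Proof. by move=> P; apply/setP => -[[b r] c]; rewrite inE mem_slicesS. Qed.

Lemma unslicesK (f : {ffun 'I_k.+1 -> {set 'I_n * 'I_n}}) :
  f ord0 = set0 -> slices (unslices f) = f.
Proof.
move=> f0; apply/ffunP => i; case: (unliftP ord0 i) => [l ->|->].
  by apply/setP => -[r c]; rewrite mem_slicesS inE.
by rewrite slices0 f0.
Qed.

Lemma mem_slicesP P (i : 'I_k.+1) p :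
  reflect (exists2 b : 'I_k, i = b.+1 :> nat & (b, p.1, p.2) \in P)
          (p \in slices P i).
Proof.
apply: (iffP idP) => [|[b ib pP]].
  case: (unliftP ord0 i) => [l ->|->]; last by rewrite slices0 inE.
  by rewrite mem_slicesS => pP; exists l.
by rewrite (_ : i = lift ord0 b) ?mem_slicesS //; apply: val_inj.
Qed.

Definition on_step P l (e : rel {set 'I_n * 'I_n}) :=
  e (slices P (widen_ord (leqnSn k) l)) (slices P (lift ord0 l)).

Lemma nonattacking_slices P :
  nonattacking P =
  [forall l : 'I_k,
     on_step P l (fun A B => matching B && [disjoint rows A & cols B])].
Proof.
apply/forall_inP/forallP => [nP l | sP [[b r] c] cP].
  have clash c d : c \in P -> d \in P -> attacking c d -> c = d.
    move=> cP dP; apply: contraTeq => cd.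
    by move/forall_inP: (nP c cP) => /(_ d dP) /implyP; apply.
  apply/andP; split.
    apply/matchingP; split=> -[r c] [r' c']; rewrite !mem_slicesS /= => pP qP.
      move=> rr; suff [-> ->]: (l, r, c) = (l, r', c') by [].
      by apply: clash => //; rewrite /attacking /same_board_attack /= rr !eqxx.
    move=> cc; suff [-> ->]: (l, r, c) = (l, r', c') by [].
    apply: clash => //.
    by rewrite /attacking /same_board_attack /= cc !eqxx orbT.
  rewrite -setI_eq0; apply/eqP/setP => x; rewrite !inE; apply/negP.
  case/andP => /imsetP[[r c] /mem_slicesP[b /= lb pP] /= ->].
  case/imsetP => -[r' c']; rewrite mem_slicesS /= => qP rc.
  have bl : (b, r, c) = (l, r', c').
    apply: clash => //.
    by rewrite /attacking /next_board_attack /= rc -lb !eqxx orbT.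
  by case: bl lb => -> _ _ /eqP; rewrite eqn_leq ltnn andbF.
(* Rooks on consecutive boards that attack along a row and a column contradict
   the disjointness at the step between these boards. *)
have next (b1 b2 : 'I_k) x y z : b1.+1 = b2 :> nat ->
    (b1, x, y) \in P -> (b2, z, x) \in P -> False.
  move=> b12 p1 p2; case/andP: (sP b2) => _ /pred0P /(_ x) /= /negP; apply.
  apply/andP; split; apply/imsetP.
    by exists (x, y) => //; apply/mem_slicesP; exists b1.
  by exists (z, x) => //; rewrite mem_slicesS.
apply/forall_inP => -[[b' r'] c'] dP; apply/implyP; apply: contra.
rewrite /attacking /same_board_attack /next_board_attack /board /row /col /=.
case/or3P=> [/andP[/eqP bb rc]|/andP[/eqP bb /eqP rc]|/andP[/eqP bb /eqP rc]].
- subst b'.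
  case/andP: (sP b) => /matchingP[rB cB] _; apply/eqP.
  case/orP: rc => /eqP rc.
    by have [-> ->] : (r, c) = (r', c') by apply: rB; rewrite ?mem_slicesS.
  by have [-> ->] : (r, c) = (r', c') by apply: cB; rewrite ?mem_slicesS.
- by rewrite rc in cP; case: (next _ _ _ _ _ bb cP dP).
- by rewrite rc in dP; case: (next _ _ _ _ _ bb dP cP).
Qed.

Lemma card_slices P : #|P| = \sum_i #|slices P i|.
Proof.
rewrite big_ord_recl slices0 cards0 add0n -sum1_card.
rewrite (partition_big (@board n k) xpredT) //=; apply: eq_bigr => b _.
rewrite -sum1_card (reindex_onto (fun p => (b, p.1, p.2))
  (fun c : cell n k => (row c, col c))) /=.
  by apply: eq_bigl => -[r c]; rewrite mem_slicesS !eqxx !andbT.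
by move=> [[b' r] c] /andP[_ /eqP <-].
Qed.

Lemma odd_subSn m i : i < m -> odd (m - i.+1) = ~~ odd (m - i).
Proof. by move=> im; rewrite -[m - i]subnSK //= negbK. Qed.

(** Grouping consecutive terms in pairs from the end: a pair is indexed by the
[i] that starts it, and [a 0] is left over if their number is odd. *)
Lemma sum_nat_pairs (a : nat -> nat) m :
  \sum_(0 <= i < m.+1) a i =
  (~~ odd m) * a 0 + \sum_(0 <= i < m | ~~ odd (m - i.+1)) (a i + a i.+1).
Proof.
have [p] := ubnP m; elim: p m => // p IHp [|[|m]] mp.
- by rewrite big_nat1 big_nil mul1n addn0.
- by rewrite big_nat_recr // [in RHS]big_mkcond /= !big_nat1.
rewrite [LHS]big_nat_recr //= big_nat_recr //= IHp; last exact: ltnW.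
rewrite [in RHS]big_mkcond !big_nat_recr //= -[in RHS]big_mkcond /=.
rewrite subnn subSn // subnn /= addn0 negbK !addnA; congr (_ + _ + _ + _).
rewrite big_nat_cond [RHS]big_nat_cond; apply: eq_bigl => i.
case: (ltnP i m) => im; rewrite ?andbF //=.
by rewrite subSS (subSn (ltnW im)) (odd_subSn im).
Qed.

Definition saturated (A B : {set 'I_n * 'I_n}) := #|A| + #|B| == n.

Lemma card_pairs P : #|P| = \sum_(l < k | ~~ odd (k - l.+1))
  (#|slices P (widen_ord (leqnSn k) l)| + #|slices P (lift ord0 l)|).
Proof.
pose a i := #|slices P (inord i)|.
rewrite card_slices (eq_bigr (fun i : 'I_k.+1 => a i)) => [|i _]; last first.
  by rewrite /a inord_val.
rewrite -(big_mkord xpredT a) sum_nat_pairs big_mkord /a.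
rewrite (_ : inord 0 = ord0) ?slices0 ?cards0 ?muln0 ?add0n; last first.
  by apply: val_inj; rewrite /= inordK.
apply: eq_bigr => l _; congr (#|slices P _| + #|slices P _|).
  by apply: val_inj; rewrite /= inordK // ltnS ltnW.
by apply: val_inj; rewrite /= inordK // ltnS.
Qed.

(** A pair has at most [n] rooks because the rows of its first board and the
columns of its second one are disjoint; if the first board is the virtual one,
because the rooks of the second one lie in distinct rows. *)
Lemma nonattacking_card P : nonattacking P ->
  #|P| <= \sum_(l < k | ~~ odd (k - l.+1)) n ?= iff
     [forall l : 'I_k, ~~ odd (k - l.+1) ==> on_step P l saturated].
Proof.
rewrite nonattacking_slices => /forallP sP; rewrite card_pairs.
apply: leqif_sum => l _; split=> //.
case/andP: (sP l) => mB dAB.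
have [l' ll'|l0] := unliftP ord0 (widen_ord (leqnSn k) l); last first.
  rewrite l0 slices0 cards0 add0n -(card_rows mB).
  by rewrite -[n in _ <= n]card_ord max_card.
move: dAB; rewrite ll'; case/andP: (sP l') => mA _.
rewrite -setI_eq0 => /eqP dAB.
rewrite -(card_rows mA) -(card_cols mB) -cardsUI dAB cards0 addn0.
by rewrite -[n in _ <= n]card_ord max_card.
Qed.

(** The witness that all pairs can be saturated simultaneously. *)
Definition alternate : {set cell n k} :=
  [set c | ~~ odd (k - (board c).+1) && (row c == col c)].

Lemma nonattacking_alternate : nonattacking alternate.
Proof.
apply/forall_inP => -[[b r] c].
rewrite inE /board /row /col /= => /andP[ob /eqP rc].
apply/forall_inP => -[[b' r'] c'].
rewrite inE /board /row /col /= => /andP[ob' /eqP rc'].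
apply/implyP; apply: contra.
rewrite /attacking /same_board_attack /next_board_attack /board /row /col /=.
rewrite rc rc' orbb.
(* Two consecutive boards are never both occupied. *)
have nb (x y : 'I_k) : ~~ odd (k - x.+1) -> ~~ odd (k - y.+1) ->
    x.+1 == y :> nat = false.
  move=> ox oy; apply/eqP => xy; move: ox oy; rewrite xy odd_subSn //.
  by move=> /negbTE ->.
by rewrite !nb //= !orbF => /andP[/eqP -> /eqP ->].
Qed.

Lemma saturated_alternate l :
  ~~ odd (k - l.+1) -> on_step alternate l saturated.
Proof.
move=> ol; rewrite /on_step /saturated.
have -> : slices alternate (widen_ord (leqnSn k) l) = set0.
  apply/setP => p; rewrite inE; apply/negP => /mem_slicesP[b /= lb].
  rewrite inE /= -lb => /andP[ob _]; move: ol.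
  by rewrite odd_subSn ?ltn_ord // (negbTE ob).
have -> : slices alternate (lift ord0 l) = [set (x, x) | x in 'I_n].
  apply/setP => -[r c]; rewrite mem_slicesS inE /row /col /= ol /=.
  apply/eqP/imsetP => [->|[x _ [-> ->]] //]; by exists c.
by rewrite cards0 card_imset ?card_ord // => x y [].
Qed.

(** The bound of [nonattacking_card] is reached by [alternate], so a placement
is maximum exactly when it is an equality case. *)
Lemma max_placement_slices P :
  max_placement P = [forall l : 'I_k, on_step P l (compatible (k - l.+1))].
Proof.
have alt_card : #|alternate| = \sum_(l < k | ~~ odd (k - l.+1)) n.
  apply/eqP; rewrite (nonattacking_card nonattacking_alternate).
  by apply/forallP => l; apply/implyP; apply: saturated_alternate.
transitivity (nonattacking P &&
    [forall l : 'I_k, ~~ odd (k - l.+1) ==> on_step P l saturated]).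
  rewrite /max_placement; apply: andb_id2l => nP.
  rewrite -(nonattacking_card nP) eqn_leq (nonattacking_card nP) /= -alt_card.
  apply/forall_inP/idP => [|altP Q nQ].
    by apply; apply: nonattacking_alternate.
  by apply: leq_trans altP; rewrite alt_card (nonattacking_card nQ).
rewrite nonattacking_slices; apply/andP/forallP=> [[/forallP sP /forallP tP] l|cP].
  rewrite /on_step /compatible andbA; apply/andP.
  by split; [apply: sP | apply: tP].
split; apply/forallP => l; have := cP l; rewrite /on_step /compatible andbA;
  by case/andP.
Qed.

(** Placements correspond to the walks that start from the empty virtual board;
a product of compatibility tests is the indicator of the maximum ones. *)
Lemma card_max_placements :
  #|[set P : {set cell n k} | max_placement P]| =
  placement_walks k (set0 : {set 'I_n * 'I_n}).
Proof.
rewrite /placement_walks -sum_prod_walk -sum1_card.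
under [RHS]eq_bigr => f _ do rewrite prod_nat_bool.
rewrite [RHS](reindex_onto slices unslices) => [|f /eqP]; last exact: unslicesK.
rewrite big_mkcond [RHS]big_mkcond /=; apply: eq_bigr => P _.
rewrite inE max_placement_slices slices0 slicesK !eqxx /=.
by case: [forall l : 'I_k, _].
Qed.

End Slices.

Theorem theorem2p7 (n k : nat) (hn : 1 <= n) (hk : 1 <= k) :
  (~~ odd k ->
     #|[set P : {set cell n k} | max_placement P]| =
     n`! ^ k./2 *
     \sum_(j : {ffun 'I_(k./2).+1 -> 'I_n.+1} | chain j)
       \prod_(l < k./2)
         ('C(n - jprev j l, n - jcur j l) * 'C(n, jcur j l)))
  /\
  (odd k ->
     #|[set P : {set cell n k} | max_placement P]| = n`! ^ (k.+1)./2).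
Proof.
rewrite card_max_placements; split=> [ek | ok].
  rewrite -{1}(even_halfK ek) placement_walks_even ?matching0 // cards0.
  congr (_ * _); rewrite (_ : inord 0 = ord0); last first.
    by apply: val_inj; rewrite /= inordK.
  (* The factors [x <= y] of the weights make up the indicator of a chain. *)
  rewrite /chain_walks -sum_prod_walk /chain.
  rewrite [RHS]big_mkcondr /=; apply: eq_bigr => j _.
  rewrite big_split /= prod_nat_bool.
  by case: ifP => _; rewrite ?mul1n.
rewrite -{1}(odd_double_half k) ok add1n placement_walks_odd /=.
by rewrite uphalf_half ok.
Qed.
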